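(* Let $k,d$ be integers with $k>3d$, $d\ge 3$ and $q-1>k+d$, and suppose that $\mathrm{char}(\mathbb{F}_q)$ does not divide $(k+1)k\cdots(d-1)$. Let $C$ be the standard Reed–Solomon code of dimension $k$ over $\mathbb{F}_q$, and let $\boldsymbol{w}$ be a word generated by a polynomial $f\in\mathbb{F}_q[T]$ of degree $k+d$. Given a real number $\epsilon>0$, if $$q>\max\{(k+1)^2,\ 12\,d^{\,2+\epsilon}\}\quad\text{and}\quad k\ge(d-2)\Big(\frac{2}{\epsilon}+1\Big),$$ then $\boldsymbol{w}$ is not a deep hole of $C$.
   Context: $\mathbb{F}_q$ is the finite field with $q$ elements. Write $\mathbb{F}_q^*=\{x_1,\dots,x_{q-1}\}$ and $n=q-1$. The standard Reed–Solomon code of dimension $k$ over $\mathbb{F}_q$ is $C:=\{(f(x_1),\dots,f(x_n)):f\in\mathbb{F}_q[T],\ \deg f\le k-1\}\subset\mathbb{F}_q^n$. The word generated by a polynomial $f\in\mathbb{F}_q[T]$ of degree at most $n-1$ is $(f(x_1),\dots,f(x_n))$. The distance of $\boldsymbol{w}\in\mathbb{F}_q^n$ to $C$ is $\mathsf{d}(\boldsymbol{w},C):=\min_{\boldsymbol{c}\in C}\mathsf{d}(\boldsymbol{w},\boldsymbol{c})$, with $\mathsf{d}$ the Hamming distance; the covering radius of $C$ is $\rho:=\max_{\boldsymbol{y}\in\mathbb{F}_q^n}\mathsf{d}(\boldsymbol{y},C)=n-k$. A word $\boldsymbol{w}$ is a deep hole of $C$ if $\mathsf{d}(\boldsymbol{w},C)=\rho$.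 Here $(k+1)k\cdots(d-1)$ is the product of all integers from $d-1$ to $k+1$. *)

(* Defs.v *)
From HB Require Import structures.
From mathcomp Require Export all_boot all_order all_algebra.
From mathcomp Require Export reals exp.

Set Implicit Arguments.
Unset Strict Implicit.
Unset Printing Implicit Defensive.

Import GRing.Theory.
Local Open Scope ring_scope.

Section Distance.
Variables (F : finFieldType) (n : nat).
Implicit Types (v w : 'rV[F]_n) (C : {set 'rV[F]_n}).

Definition hamming v w : nat := #|[set i | v 0 i != w 0 i]|.

(* The default value n bounds every Hamming distance in F^n, so this is the
   genuine minimum whenever C is nonempty. *)
Definition dist_code w C : nat := \big[minn/n]_(c in C) hamming w c.

Definition covering_radius C : nat := (\max_(y : 'rV[F]_n) dist_code y C)%N.

Definition deep_hole C w : Prop := dist_code w C = covering_radius C.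

End Distance.

Section ReedSolomon.
Variable F : finFieldType.

Definition enumerates_nonzero (n : nat) (x : 'I_n -> F) : Prop :=
  injective x /\ forall y : F, y != 0 <-> exists i, x i = y.

Definition word_of (n : nat) (x : 'I_n -> F) (f : {poly F}) : 'rV[F]_n :=
  \row_i f.[x i].

(* {poly_k F} is the type of polynomials of size at most k, i.e., of degree at
   most k - 1. *)
Definition RS_code (n : nat) (x : 'I_n -> F) (k : nat) : {set 'rV[F]_n} :=
  [set word_of x (f : {poly F}) | f : {poly_k F}].

End ReedSolomon.

(* Main.v *)
(* Let q = #|F|. For a set S of k - 1 nonzero points, put
   P = \prod_(s in S) (X - s) and f = P Q + T, with deg Q = d + 1 and deg T < k - 1. If Q(y) = Q(z) for
   distinct nonzero y, z outside S, then f - (T + Q(y) P) = P (Q - Q(y)) vanishes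
   on S, y and z, so f agrees with a polynomial of degree < k at k + 1 points and
   is not a deep hole.
   Otherwise Q is injective off the k points of S and 0. The function
   v |-> #|Q^-1(v)| - 1 is then supported on at most 2k points, and its moments of
   order < 2k vanish because (d + 1)(2k - 1) < q - 1; hence it is 0 in F, and
   \sum_x Q(x)^m = 0 for all m < q - 1. Take m minimal with
   (d + 1) m = q - 1 + r, r >= 0: that sum is minus the coefficient of X^(q-1) in
   Q^m, i.e., minus the coefficient of t^r in
   f~(t)^m \prod_(s in S) (1 - s t)^(-m), where f~ is the reversed polynomial.
   As p does not divide m, differencing in r of the points of S shows that this
   coefficient is nonzero for a suitable S. *)
Require Import Defs.
From mathcomp Require Import finfield zify ring.
Import Order.TTheory GRing.Theory Num.Theory.
Local Open Scope ring_scope.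

Set Implicit Arguments.
Unset Strict Implicit.
Unset Printing Implicit Defensive.

(** * Power sums and moments over a finite field *)

Section PowerSums.
Variable F : finFieldType.
Implicit Types (g : {poly F}) (A : {set F}).

Lemma card_finField_pchar p : p \in [pchar F] -> exists n, #|F| = (p ^ n)%N.
Proof. by move=> pF; exists (logn p #|F|); exact: card_pprimeChar pF. Qed.

Lemma card_finField_natr : #|F|%:R = 0 :> F.
Proof.
have [p p_pr pF] := finPcharP F.
apply/eqP; rewrite -(dvdn_pcharf pF); have := finNzRing_gt1 F.
have [n ->] := card_finField_pchar pF.
by case: n => // n _; rewrite expnS dvdn_mulr.
Qed.

(** Multiplying the variable by a nonzero [a] with [a ^+ e != 1] rescales the sum; for [e > 0] such
    an [a] exists because [X^e - 1] has at most [e] roots. *)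
Lemma sum_expr_small (e : nat) : (e < #|F|.-1)%N -> \sum_(x : F) x ^+ e = 0.
Proof.
have q_gt1 : (1 < #|F|)%N := finNzRing_gt1 F.
case: e => [|e] lt_e; first by rewrite sumr_const card_finField_natr.
have [a a_neq0 ae_neq1] : exists2 a : F, a != 0 & a ^+ e.+1 != 1.
  suff : [exists a : F, (a != 0) && (a ^+ e.+1 != 1)].
    by case/existsP=> a /andP[]; exists a.
  apply: contraLR lt_e => /existsPn roots; rewrite -leqNgt.
  have -> : e.+1 = (size ('X^(e.+1) - 1%:P : {poly F})).-1 by rewrite size_XnsubC.
  rewrite -(cardC1 (0 : F)) cardE -ltnS prednK; last first.
    by rewrite size_XnsubC.
  apply: max_poly_roots; last exact: enum_uniq.
    by rewrite -size_poly_gt0 size_XnsubC.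
  apply/allP=> a; rewrite mem_enum => a_neq0.
  have := roots a; rewrite negb_and negbK (negPf a_neq0) /= negbK => /eqP ae.
  by rewrite rootE !hornerE ae subrr.
have /eqP : (a ^+ e.+1 - 1) * \sum_(x : F) x ^+ e.+1 = 0.
  rewrite mulrBl mul1r mulr_sumr [X in _ - X](reindex_inj (mulfI a_neq0)) /=.
  by under [X in _ - X]eq_bigr do rewrite exprMn; rewrite subrr.
by rewrite mulf_eq0 subr_eq0 (negPf ae_neq1) => /eqP.
Qed.

Lemma sum_expr_card_pred : \sum_(x : F) x ^+ #|F|.-1 = -1.
Proof.
have q_gt1 : (1 < #|F|)%N := finNzRing_gt1 F.
have /negPf q1_neq0 : (#|F|.-1 != 0)%N by lia.
rewrite (bigD1 0) //= expr0n q1_neq0 add0r.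
rewrite (eq_bigr (fun=> 1)) => [|x x_neq0].
  rewrite sumr_const cardC1 -[RHS]add0r -card_finField_natr.
  by rewrite -[X in X%:R - _](ltn_predK q_gt1) -natr1 addrK.
apply: (mulfI x_neq0).
by rewrite -exprS (ltn_predK q_gt1) expf_card mulr1.
Qed.

(** Among the exponents below 2(q - 1), with q = [#|F|], only q - 1 has a nonzero power sum. *)
Lemma sum_horner_coef g : (size g <= (#|F|.-1).*2)%N ->
  \sum_(x : F) g.[x] = - g`_(#|F|.-1).
Proof.
move: (@sum_expr_small) sum_expr_card_pred (@expf_card F) (finNzRing_gt1 F).
set q := #|F| => sum_small sum_q1 expr_q q_gt1 size_g.
have -> : \sum_(x : F) g.[x] = \sum_(i < (q.-1).*2) g`_i * \sum_(x : F) x ^+ i.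
  under eq_bigr do rewrite (horner_coef_wide _ size_g).
  by rewrite exchange_big; apply: eq_bigr => i _; rewrite mulr_sumr.
have lt_q : (q.-1 < (q.-1).*2)%N by lia.
rewrite (bigD1 (Ordinal lt_q)) //= sum_q1 mulrN1 big1 ?addr0 //.
move=> i; rewrite -val_eqE /= => i_neq; have lt_i2 := ltn_ord i.
case: (ltnP i q.-1) => [lt_i|le_i]; first by rewrite sum_small ?mulr0.
have eq_i : (i = q + (i - q) :> nat)%N by lia.
rewrite (eq_bigr (fun x : F => x ^+ (i - q).+1)) => [|x _].
  by rewrite sum_small ?mulr0 //; lia.
by rewrite {1}eq_i exprD expr_q exprS.
Qed.

(* Pairing c with the polynomial vanishing on the rest of its support isolates
   one value of c. *)
Lemma moments_eq0 (c : F -> F) (n : nat) :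
  (#|[set v | c v != 0%R]| <= n)%N ->
  (forall m, (m < n)%N -> \sum_(v : F) c v * v ^+ m = 0) ->
  forall v, c v = 0.
Proof.
set T := [set v | _] => card_T mom v; apply/eqP; apply: contraT => cv.
have Tv : v \in T by rewrite inE.
pose h := \prod_(u <- enum (T :\ v)) ('X - u%:P).
have size_h : (size h <= n)%N.
  by rewrite size_prod_XsubC -cardE; move: (cardsD1 v T); rewrite Tv; lia.
have : \sum_(u : F) c u * h.[u] = 0.
  under eq_bigr do rewrite (horner_coef_wide _ size_h) mulr_sumr.
  rewrite exchange_big big1 //= => i _.
  under eq_bigr do rewrite mulrCA.
  by rewrite -mulr_sumr mom ?mulr0.
have rooth u : root h u = (u \in T :\ v) by rewrite root_prod_XsubC mem_enum.
rewrite (bigD1 v) //= big1 => [|u u_neq].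
  move/eqP; rewrite addr0 mulf_eq0 -/(root h v) rooth !inE eqxx (negPf cv).
  by [].
case: (boolP (u \in T)) => [Tu|]; last first.
  by rewrite inE negbK => /eqP->; rewrite mul0r.
have /rootP-> : root h u by rewrite rooth !inE u_neq; move: Tu; rewrite inE.
by rewrite mulr0.
Qed.

Lemma sum_horner_expr_eq0 g A (m : nat) :
  (1 < size g)%N -> {in ~: A &, injective (horner g)} ->
  ((size g).-1 * (#|A|.*2.-1) < #|F|.-1)%N ->
  (m < #|F|.-1)%N -> \sum_(x : F) g.[x] ^+ m = 0.
Proof.
move=> g_gt1 inj_g size_g lt_m.
pose c v : F := #|[set x | g.[x] == v]|%:R - 1.
have sum_c (e : nat) : (e < #|F|.-1)%N ->
    \sum_(x : F) g.[x] ^+ e = \sum_v c v * v ^+ e.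
  move=> lt_e; under [RHS]eq_bigr do rewrite mulrBl mul1r.
  rewrite sumrB sum_expr_small // subr0.
  rewrite (partition_big (horner g) xpredT) //=; apply: eq_bigr => v _.
  rewrite (eq_bigr (fun=> v ^+ e)) => [|x /eqP-> //].
  by rewrite sumr_const mulr_natl cardsE.
suff c0 v : c v = 0 by rewrite sum_c // big1 // => v _; rewrite c0 mul0r.
apply: (moments_eq0 (n := #|A|.*2)) => [|e lt_e].
  (* A value whose fibre is not a single point lies in the image of [A] or is missed by the
     complement of [A]; each of these sets has at most [#|A|] elements. *)
  apply: (@leq_trans #|(horner g @: A) :|: ~: (horner g @: ~: A)|).
    apply/subset_leq_card/subsetP => u; rewrite !inE; apply: contraNT.
    rewrite negb_or negbK => /andP[uA /imsetP[y Ay uE]].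
    suff card1 : #|[set z | g.[z] == u]| = 1%N by rewrite /c card1 subrr.
    apply/eqP/cards1P; exists y; apply/setP=> z; rewrite !inE.
    apply/eqP/eqP=> [gz|->//].
    apply: inj_g => //; last by rewrite gz.
    by rewrite inE; apply: contraNN uA => Az; rewrite -gz imset_f.
  rewrite (leq_trans (leq_card_setU _ _)) //.
  rewrite -addnn leq_add ?leq_imset_card //.
  rewrite -(leq_add2l #|horner g @: ~: A|) cardsC (card_in_imset inj_g).
  by rewrite addnC cardsC.
(* As [e <= #|A|.*2.-1], the degree of [g ^+ e] is below q - 1, so its coefficient at q - 1 is 0. *)
have lt_deg : ((size g).-1 * e < #|F|.-1)%N.
  by apply: leq_ltn_trans size_g; rewrite leq_mul2l; apply/orP; right; lia.
have lt_eq : (e < #|F|.-1)%N by apply: leq_ltn_trans lt_deg; nia.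
rewrite -sum_c //.
have size_ge : (size (g ^+ e) <= #|F|.-1)%N.
  by apply: leq_trans (size_poly_exp_leq _ _) _.
under eq_bigr do rewrite -horner_exp.
rewrite sum_horner_coef; last first.
  by rewrite (leq_trans size_ge) // -addnn leq_addr.
by rewrite nth_default ?oppr0.
Qed.
End PowerSums.

(** * Reversed polynomials and truncated products *)

Section Reversal.
Variable F : fieldType.
Implicit Types (f g h : {poly F}).

(* X^n f(1/X), for f of degree at most n. *)
Definition rev_poly (n : nat) f : {poly F} := \poly_(i < n.+1) f`_(n - i).

Lemma coef_rev_poly n f i : (i <= n)%N -> (rev_poly n f)`_i = f`_(n - i).
Proof. by move=> le_i; rewrite coef_poly ltnS le_i. Qed.

Lemma rev_polyD n f g : rev_poly n (f + g) = rev_poly n f + rev_poly n g.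
Proof.
by apply/polyP=> i; rewrite coefD !coef_poly coefD; case: ifP; rewrite ?addr0.
Qed.

Lemma rev_polyZ n c f : rev_poly n (c *: f) = c *: rev_poly n f.
Proof.
by apply/polyP=> i; rewrite coefZ !coef_poly coefZ; case: ifP; rewrite ?mulr0.
Qed.

Lemma rev_polyXn n i : (i <= n)%N -> rev_poly n 'X^i = 'X^(n - i).
Proof.
move=> le_i; apply/polyP=> j; rewrite coef_poly !coefXn.
by case: ifP => lt_j; [congr (_%:R)|symmetry]; case: eqP => //; lia.
Qed.

Lemma rev_poly_sum n (I : Type) (s : seq I) (G : I -> {poly F}) :
  rev_poly n (\sum_(i <- s) G i) = \sum_(i <- s) rev_poly n (G i).
Proof.
have rev0 : rev_poly n 0 = 0.
  by apply/polyP=> i; rewrite coef_poly !coef0 if_same.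
exact: (big_morph (rev_poly n) (rev_polyD n) rev0).
Qed.

Lemma rev_polyM a b f g : (size f <= a.+1)%N -> (size g <= b.+1)%N ->
  rev_poly (a + b) (f * g) = rev_poly a f * rev_poly b g.
Proof.
have sumE n h : (size h <= n.+1)%N -> h = \sum_(i < n.+1) h`_i *: 'X^i.
  move=> size_h; rewrite -poly_def; apply/polyP=> i; rewrite coef_poly.
  by case: ltnP => // le_i; rewrite nth_default // (leq_trans size_h).
move=> /sumE fE /sumE gE; rewrite fE gE.
rewrite mulr_suml !rev_poly_sum mulr_suml; apply: eq_bigr => i _.
rewrite !mulr_sumr rev_poly_sum; apply: eq_bigr => j _.
have [lt_i lt_j] := (ltn_ord i, ltn_ord j).
rewrite -scalerAl -scalerAr -exprD !rev_polyZ !rev_polyXn; try lia.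
rewrite -scalerAl -scalerAr -exprD; congr (_ *: (_ *: 'X^_)); lia.
Qed.

Lemma rev_polyX n m f : (size f <= n.+1)%N ->
  rev_poly (n * m) (f ^+ m) = rev_poly n f ^+ m.
Proof.
move=> size_f; elim: m => [|m IHm].
  by rewrite muln0 !expr0 -(expr0 'X) rev_polyXn.
rewrite mulnS !exprS rev_polyM ?IHm //.
by apply: leq_trans (size_poly_exp_leq _ _) _; rewrite ltnS leq_mul2r; lia.
Qed.

Lemma rev_poly_XsubC (s : seq F) :
  rev_poly (size s) (\prod_(a <- s) ('X - a%:P)) =
    \prod_(a <- s) (1 - a *: 'X).
Proof.
elim: s => [|a s IHs]; first by rewrite !big_nil -(expr0 'X) rev_polyXn.
rewrite !big_cons /= -add1n rev_polyM ?size_XsubC ?size_prod_XsubC // IHs.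
congr (_ * _); apply/polyP=> i; rewrite coef_poly !coefE.
by case: i => [|[|i]] //=; rewrite ?coefE /=; ring.
Qed.

(** Congruence modulo X^n. *)
Definition eq_trunc (n : nat) f g := forall i, (i < n)%N -> f`_i = g`_i.

Lemma eq_truncM n f1 f2 g1 g2 :
  eq_trunc n f1 g1 -> eq_trunc n f2 g2 -> eq_trunc n (f1 * f2) (g1 * g2).
Proof.
move=> eq1 eq2 i lt_i; rewrite !coefM; apply: eq_bigr => j _.
rewrite eq1 ?eq2 //; first exact: leq_ltn_trans (leq_subr _ _) lt_i.
exact: leq_trans (ltn_ord j) lt_i.
Qed.

Lemma eq_truncX n m f g : eq_trunc n f g -> eq_trunc n (f ^+ m) (g ^+ m).
Proof.
by move=> eqfg; elim: m => [|m IHm]; rewrite ?expr0 // !exprS; apply: eq_truncM.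
Qed.

(** Reversal moves the low-degree [T] to indices at least [n], so the division looks exact modulo
    X^n. *)
Lemma rev_poly_division n f P Q T a b :
  f = Q * P + T -> (size P <= a.+1)%N -> (size Q <= b.+1)%N ->
  (size T + n <= (b + a).+1)%N ->
  eq_trunc n (rev_poly (b + a) f) (rev_poly b Q * rev_poly a P).
Proof.
move=> -> size_P size_Q size_T i lt_i.
rewrite rev_polyD rev_polyM // coefD [X in _ + X]coef_rev_poly; last by lia.
have size_Ti : (size T <= b + a - i)%N by lia.
by rewrite [X in _ + X]nth_default ?addr0.
Qed.

(* Each pair a, b of points of L contributes a factor (1 - a X)^M - (1 - b X)^M
   of valuation exactly 1; expanding the product of r of them gives a choice of
   one point per pair. *)
Lemma exists_prod_coef_neq0 (M : nat) (L : seq F) (r j : nat) (B : {poly F}) :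
  M%:R != 0 :> F -> uniq L -> (r.*2 <= size L)%N ->
  (forall i, (i < j)%N -> B`_i = 0) -> B`_j != 0 ->
  exists S : seq F, [/\ uniq S, size S = r, {subset S <= L} &
    (B * \prod_(a <- S) (1 - a *: 'X) ^+ M)`_(j + r) != 0].
Proof.
move=> M_neq0; elim: r j B L => [|r IHr] j B L.
  move=> _ _ _ Bj; exists [::]; split=> //.
  by rewrite big_nil mulr1 addn0.
case: L => [|a [|b L]] // /= /and3P[]; rewrite inE negb_or.
move=> /andP[a_neq_b aL] bL uniqL; rewrite !ltnS => size_L B_small Bj.
pose E := (1 - a *: 'X) ^+ M - (1 - b *: 'X) ^+ M : {poly F}.
(* [E'] is b - a times a sum of [M] terms with constant term 1, so its constant term is (b - a)
   M. *)
have [E' EE E'0] : exists2 E', E = 'X * E' & E'`_0 != 0.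
  pose W := \sum_(i < M) (1 - a *: 'X) ^+ (M.-1 - i) * (1 - b *: 'X) ^+ i.
  exists ((b - a) *: W : {poly F}).
    rewrite /E subrXX -/W -!mul_polyC polyCB; ring.
  rewrite coefZ mulf_neq0 //; first by rewrite subr_eq0 eq_sym.
  rewrite -horner_coef0 horner_sum.
  rewrite (eq_bigr (fun=> 1)) => [|i _].
    by rewrite sumr_const card_ord.
  by rewrite !hornerE ?mulr0 ?subr0 ?expr1n ?mulr1.
have [S [uniqS size_S subS coefS]] : exists S : seq F,
    [/\ uniq S, size S = r, {subset S <= L} &
    ((B * E) * \prod_(a <- S) (1 - a *: 'X) ^+ M)`_(j.+1 + r) != 0].
  apply: IHr => // [i lt_i|]; rewrite EE mulrCA coefXM.
    case: eqP => // i_neq0; rewrite coefM big1 // => l _; rewrite B_small ?mul0r //.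
    by apply: leq_trans (ltn_ord l) _; lia.
  rewrite coefM big_ord_recr /= subnn big1 ?add0r ?mulf_neq0 //.
  by move=> l _; rewrite B_small ?mul0r.
(* The coefficient for [E] is the difference of those for [a :: S] and [b :: S], so these cannot
   both vanish. *)
have [nza|/negPn/eqP za] := boolP ((B * \prod_(c <- a :: S)
    (1 - c *: 'X) ^+ M)`_(j + r.+1) != 0).
  exists (a :: S); split=> //=; last 1 first.
  - move=> c; rewrite !inE => /orP[->//|/subS->]; by rewrite !orbT.
  - by rewrite uniqS andbT; apply: contra aL => /subS.
  - by rewrite size_S.
exists (b :: S); split=> //=.
- by rewrite uniqS andbT; apply: contra bL => /subS.
- by rewrite size_S.
- by move=> c; rewrite !inE => /orP[->|/subS->]; rewrite !orbT.
move: coefS za; rewrite !big_cons /E mulrBr mulrBl coefB addSnnS -!mulrA.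
by move=> + za; rewrite za sub0r oppr_eq0.
Qed.
End Reversal.

(** * Powers of the quotient of [f] by a product of linear factors *)

Section Quotient.
Variable F : finFieldType.
Implicit Types (f g : {poly F}) (S : seq F).

(** By Frobenius, (1 + h X)^q = 1 + h^q X^q for q = [#|F|]. *)
Lemma eq_trunc_expr_card g : g`_0 = 1 -> eq_trunc #|F| (g ^+ #|F|) 1.
Proof.
move=> g0.
have [p p_pr pF] := finPcharP F.
have q_pnat : ([pchar {poly F}]).-nat #|F|.
  rewrite (eq_pnat _ (pchar_poly F)) (eq_pnat _ (pcharf_eq pF)).
  have [n ->] := card_finField_pchar pF.
  by rewrite pnatX pnat_id.
have /factor_theorem[h hE] : root (g - 1) 0.
  by rewrite rootE !hornerE horner_coef0 g0 subrr.
have -> : g = 1 + h * 'X by rewrite -[X in _ * X]subr0 -hE; ring.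
move=> i lt_i; rewrite exprDn_pchar // expr1n exprMn coefD coefMXn lt_i.
by rewrite addr0.
Qed.

(* Modulo X^#|F|, the inverse of a polynomial with constant term 1 is its power
   of exponent #|F| - 1. *)
Lemma coef_expr_divp f S (D m r : nat) :
  size f = (D + size S).+1 -> (r <= D)%N -> (D < #|F|)%N -> (r <= D * m)%N ->
  ((f %/ \prod_(a <- S) ('X - a%:P)) ^+ m)`_(D * m - r) =
  (rev_poly (D + size S) f ^+ m *
     \prod_(a <- S) (1 - a *: 'X) ^+ (#|F|.-1 * m))`_r.
Proof.
set P := \prod_(a <- S) _ => size_f le_r lt_D le_rm.
have size_P : size P = (size S).+1 by rewrite size_prod_XsubC.
have P_neq0 : P != 0 by rewrite -size_poly_gt0 size_P.
have size_Q : size (f %/ P) = D.+1.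
  by rewrite size_divp // size_f size_P /= -addSn addnK.
have size_T : (size (f %% P)%R <= size S)%N.
  by rewrite -ltnS -size_P ltn_modp.
rewrite -coef_rev_poly // rev_polyX ?size_Q //.
have lt_r : (r < D.+1)%N by [].
move: r lt_r {le_r le_rm}.
set V := rev_poly (size S) P.
have VE : V = \prod_(a <- S) (1 - a *: 'X) by exact: rev_poly_XsubC.
have V0 : V`_0 = 1.
  rewrite coef_rev_poly // subn0 -(monicP (monic_prod_XsubC S xpredT id)).
  by rewrite lead_coefE size_P.
have Vq : eq_trunc D.+1 (V ^+ #|F|) 1.
  by move=> i lt_i; rewrite eq_trunc_expr_card //; apply: leq_trans lt_i lt_D.
have eq1 : eq_trunc D.+1 (rev_poly (D + size S) f) (rev_poly D (f %/ P) * V).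
  apply: rev_poly_division (divp_eq f P) _ _ _; rewrite ?size_P ?size_Q //.
  by rewrite addnS ltnS addnC leq_add2l.
have eq2 : eq_trunc D.+1 (rev_poly D (f %/ P))
    (rev_poly (D + size S) f * V ^+ #|F|.-1).
  move=> i lt_i.
  have -> : (rev_poly D (f %/ P))`_i = (rev_poly D (f %/ P) * V ^+ #|F|)`_i.
    by rewrite (eq_truncM (fun _ _ => erefl) Vq) ?mulr1.
  rewrite -(ltn_predK lt_D) exprS mulrA.
  by symmetry; apply: (eq_truncM eq1).
have := eq_truncX m eq2.
by rewrite exprMn -exprM VE prodrXl.
Qed.

(** Fix [k - r] of the points; the last [r] come from disjoint pairs among the other nonzero points,
    of which at least 2r remain because [k + r < #|F|]. *)
Lemma exists_divisor_coef_neq0 f (D m r k : nat) :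
  size f = (D + k).+1 -> (r <= D)%N -> (r <= k)%N -> (D < #|F|)%N ->
  (r <= D * m)%N -> (k + r < #|F|)%N -> m%:R != 0 :> F ->
  exists S, [/\ uniq S, size S = k, 0 \notin S &
    ((f %/ \prod_(a <- S) ('X - a%:P)) ^+ m)`_(D * m - r) != 0].
Proof.
move=> size_f le_rD le_rk lt_D le_rm lt_kr m_neq0.
pose L := enum (predC1 (0 : F)).
have uniqL : uniq L by exact: enum_uniq.
have size_L : size L = #|F|.-1 by rewrite -cardE cardC1.
pose S0 := take (k - r) L; pose L' := drop (k - r) L.
have size_S0 : size S0 = (k - r)%N.
  by rewrite size_takel // size_L; lia.
have size_L' : size L' = (#|F|.-1 - (k - r))%N by rewrite size_drop size_L.
move: uniqL; rewrite -(cat_take_drop (k - r) L) cat_uniq.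
rewrite -/S0 -/L' => /and3P[uniqS0 disj uniqL'].
pose M := (#|F|.-1 * m)%N.
(* [#|F|] is 0 in [F], so [M] becomes - m there. *)
have M_neq0 : M%:R != 0 :> F.
  rewrite natrM mulf_neq0 // -subn1 natrB ?(leq_trans _ lt_D) //.
  by rewrite card_finField_natr sub0r oppr_eq0 oner_eq0.
pose B := rev_poly (D + k) f ^+ m * \prod_(a <- S0) (1 - a *: 'X) ^+ M.
have B0 : B`_0 != 0.
  rewrite -horner_coef0 hornerM horner_exp horner_coef0 coef_rev_poly // subn0.
  rewrite mulf_neq0 ?expf_neq0 //.
    have -> : (D + k)%N = (size f).-1 by rewrite size_f.
    by rewrite -lead_coefE lead_coef_eq0 -size_poly_gt0 size_f.
  rewrite horner_prod big1 ?oner_neq0 // => a _.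
  by rewrite !hornerE ?mulr0 ?subr0 ?expr1n.
have size_rL' : (r.*2 <= size L')%N by rewrite size_L'; lia.
have [S1 [uniqS1 size_S1 subS1 coefS1]] := exists_prod_coef_neq0
  M_neq0 uniqL' size_rL' (fun i (lt : (i < 0)%N) => False_ind _ (notF lt)) B0.
have size_S : size (S0 ++ S1) = k by rewrite size_cat size_S0 size_S1 subnK.
exists (S0 ++ S1); split => //.
- rewrite cat_uniq uniqS0 uniqS1 andbT; apply: contra disj => /hasP[a aS1 aS0].
  by apply/hasP; exists a => //; apply: subS1.
- have sub0 : {subset S0 ++ S1 <= L}.
    by move=> a; rewrite mem_cat => /orP[/mem_take //|/subS1/mem_drop].
  by apply/negP=> /sub0; rewrite mem_enum inE eqxx.
by rewrite coef_expr_divp ?size_S // big_cat /= mulrA.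
Qed.
End Quotient.

(** * Hamming distance and Reed-Solomon codes *)

Section Distance.
Variable F : finFieldType.

Lemma dist_code_le n (C : {set 'rV[F]_n}) w c :
  c \in C -> (dist_code w C <= hamming w c)%N.
Proof.
move=> cC; rewrite /dist_code; have := mem_index_enum c.
elim: (index_enum _) => // a s IHs; rewrite inE big_cons.
case/predU1P => [<-|/IHs le_s]; first by rewrite cC geq_minl.
by case: ifP => // _; rewrite geq_min le_s orbT.
Qed.

Lemma leq_dist_code n (C : {set 'rV[F]_n}) w (e : nat) :
  (e <= n)%N -> (forall c, c \in C -> (e <= hamming w c)%N) ->
  (e <= dist_code w C)%N.
Proof.
move=> le_en le_e; rewrite /dist_code.
by elim/big_ind: _ => // a b le_a le_b; rewrite leq_min le_a.
Qed.

Lemma hamming_word_of n (x : 'I_n -> F) (f g : {poly F}) :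
  (hamming (word_of x f) (word_of x g) + #|[set i | root (f - g) (x i)]|)%N = n.
Proof.
rewrite -[RHS]card_ord -(cardsC [set i | root (f - g) (x i)]) addnC.
congr (_ + _)%N; apply: eq_card => i.
by rewrite !inE !mxE rootE hornerD hornerN subr_eq0.
Qed.

(** The word of ['X^k] is a witness: for every codeword polynomial [g], the difference ['X^k - g]
    has degree [k], hence at most [k] roots. *)
Lemma covering_radius_RS_code n (x : 'I_n -> F) (k : nat) :
  injective x -> (n - k <= covering_radius (RS_code x k))%N.
Proof.
move=> inj_x; apply: leq_trans (leq_bigmax (word_of x 'X^k)).
apply: leq_dist_code => [|c /imsetP[g _ ->]]; first exact: leq_subr.
rewrite leq_subLR -{1}(hamming_word_of x 'X^k g) addnC leq_add2r.
have size_g : (size (- (g : {poly F})) < size ('X^k : {poly F}))%N.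
  by rewrite size_polyN size_polyXn ltnS; apply: size_npoly.
have size_h : size ('X^k - (g : {poly F})) = k.+1.
  by rewrite size_polyDl // size_polyXn.
rewrite -(card_imset _ inj_x) cardE -ltnS -size_h.
apply: max_poly_roots; rewrite ?enum_uniq //.
  by rewrite -size_poly_gt0 size_h.
by apply/allP=> a; rewrite mem_enum => /imsetP[i + ->]; rewrite inE.
Qed.

(** Agreement with a codeword at more than [k] points puts the word at distance less than [n - k],
    which is at most the covering radius. *)
Lemma RS_not_deep_hole n (x : 'I_n -> F) (k : nat) (f g : {poly F}) (T : seq F) :
  enumerates_nonzero x -> (size g <= k)%N -> (k < n)%N ->
  uniq T -> 0 \notin T -> all (root (f - g)) T -> (k < size T)%N ->
  ~ deep_hole (RS_code x k) (word_of x f).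
Proof.
move=> [inj_x x_onto] size_g lt_kn uniqT T0 rootT lt_kT deep.
have := covering_radius_RS_code k inj_x; rewrite -deep leqNgt => /negP; apply.
have gC : word_of x g \in RS_code x k.
  by apply/imsetP; exists (npolyp k g); rewrite ?npolypK.
apply: leq_ltn_trans (dist_code_le _ gC) _.
have := hamming_word_of x f g.
suff : (size T <= #|[set i | root (f - g) (x i)]|)%N by lia.
rewrite -(card_imset _ inj_x) -(card_uniqP uniqT).
apply/subset_leq_card/subsetP => t tT; have rt := allP rootT t tT.
have /x_onto[i xi] : t != 0 by apply: contraNneq T0 => <-.
by rewrite -xi imset_f // inE xi.
Qed.
End Distance.

(** * Divisibility, choice of the exponent, and conclusion *)

Lemma dvdn_prod_nat (a b p : nat) :
  (0 < p)%N -> (a + p <= b.+1)%N -> (p %| \prod_(a <= i < b.+1) i)%N.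
Proof.
move=> p_gt0 le_ap.
(* The witness is the largest multiple of [p] that is at most [b]. *)
have c_in : (b %/ p * p)%N \in index_iota a b.+1.
  by rewrite mem_index_iota; have := divn_eq b p; have := ltn_pmod b p_gt0; lia.
by rewrite (bigD1_seq _ c_in (iota_uniq _ _)) /= dvdn_mulr // dvdn_mull.
Qed.

(* With m minimal such that D m >= q - 1, where q = p ^ n: if p divided m, then
   r = 1, so that D would divide q. *)
Lemma exists_exponent (p n D : nat) : prime p -> (1 < D < p)%N -> (0 < n)%N ->
  exists m r : nat, [/\ (D * m = (p ^ n).-1 + r)%N, (r < D)%N & ~~ (p %| m)%N].
Proof.
move=> p_pr /andP[D_gt1 lt_Dp] n_gt0; set q := (p ^ n)%N.
have q_gt1 : (1 < q)%N by rewrite -(exp1n n) ltn_exp2r // prime_gt1.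
have p_q : (p %| q)%N by rewrite dvdn_exp.
pose m := ((q.-1 + D.-1) %/ D)%N; pose r := (D * m - q.-1)%N.
have [Dm lt_r] : (D * m = q.-1 + r)%N /\ (r < D)%N.
  have := divn_eq (q.-1 + D.-1) D; have := ltn_pmod (q.-1 + D.-1) (ltnW D_gt1).
  by rewrite -/m [(D * m)%N]mulnC /r [(D * m)%N]mulnC; lia.
exists m, r; split=> //; apply/negP=> p_m.
have : (p %| D * m)%N by rewrite dvdn_mull.
rewrite Dm; case: r Dm lt_r => [|r] Dm lt_r.
  rewrite addn0 => p_q1; have : (p %| q - q.-1)%N by rewrite dvdn_sub.
  have q1 : (q - q.-1 = 1)%N by lia.
  by rewrite q1 Euclid_dvd1.
(* Here [r] is one less than the original remainder; [p] divides it and exceeds it, so it is 0. *)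
have -> : (q.-1 + r.+1 = q + r)%N by lia.
rewrite dvdn_addr // => p_r; have r0 : r = 0%N.
  by apply/eqP; apply: contraT; rewrite -lt0n => /dvdn_leq/(_ p_r); lia.
have D_q : (D %| q)%N by apply/dvdnP; exists m; rewrite mulnC Dm r0; lia.
have : (pdiv D %| p)%N.
  have := dvdn_trans (pdiv_dvd D) D_q.
  by rewrite Euclid_dvdX ?pdiv_prime // => /andP[].
rewrite dvdn_prime2 ?pdiv_prime // => /eqP pD.
by have := pdiv_leq (ltnW D_gt1); rewrite pD; lia.
Qed.

Theorem theorem7p10 (R : realType) (F : finFieldType) (p : nat)
  (x : 'I_(#|F|.-1) -> F) (k d : nat) (f : {poly F}) (w : 'rV[F]_(#|F|.-1))
  (eps : R) :
  p \in [pchar F] ->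
  enumerates_nonzero x ->
  (3 * d < k)%N -> (3 <= d)%N -> (k + d < #|F|.-1)%N ->
  ~~ (p %| \prod_(d.-1 <= i < k.+2) i)%N ->
  size f = (k + d).+1 ->
  w = word_of x f ->
  0 < eps ->
  Num.max ((k + 1)%:R ^+ 2) (12%:R * d%:R `^ (2 + eps)) < #|F|%:R :> R ->
  (d%:R - 2) * (2 / eps + 1) <= k%:R :> R ->
  ~ deep_hole (RS_code x k) w.
Proof.
move=> pF x_enum lt_dk le_d lt_kd ndvd size_f -> _ + _.
rewrite gt_max => /andP[+ _]; rewrite -natrX ltr_nat => lt_kq.
have p_pr := pcharf_prime pF.
(* Otherwise [p] divides one of the consecutive integers from d - 1 to k + 1, since [3 * d < k]
   makes them more than d + 1 in number. *)
have lt_dp : (d.+1 < p)%N.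
  rewrite ltnNge; apply: contra ndvd => le_pd.
  by apply: dvdn_prod_nat; [exact: prime_gt0 | lia].
have [n qE] := card_finField_pchar pF.
have n_gt0 : (0 < n)%N by case: n qE lt_kd => // ->.
have d_int : (1 < d.+1 < p)%N by lia.
have [m [r [Dm lt_rd ndvd_m]]] := exists_exponent p_pr d_int n_gt0.
rewrite -qE in Dm.
have m_neq0 : m%:R != 0 :> F by rewrite -(dvdn_pcharf pF).
have size_f' : size f = (d.+1 + k.-1).+1 by rewrite size_f; lia.
have [S [uniqS size_S S0 coefS]] : exists S, [/\ uniq S, size S = k.-1,
    0 \notin S & ((f %/ \prod_(a <- S) ('X - a%:P)) ^+ m)`_(d.+1 * m - r) != 0].
  by apply: exists_divisor_coef_neq0; lia.
move: coefS; rewrite Dm addnK; set P := \prod_(a <- S) _; set Q := f %/ P.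
move=> coefQ.
have size_P : size P = k by rewrite size_prod_XsubC size_S prednK //; lia.
have P_neq0 : P != 0 by rewrite -size_poly_gt0 size_P; lia.
have size_Q : size Q = d.+2 by rewrite size_divp // size_P size_f'; lia.
(* 0 joins [S] because power sums run over all of [F], whereas evaluation points are nonzero. *)
pose A := [set a in 0 :: S].
have card_A : #|A| = k.
  by rewrite cardsE (card_uniqP _) /= ?S0 // size_S prednK //; lia.
have [/existsP[y /existsP[z /and4P[yA zA y_neq_z /eqP Qyz]]]|/existsPn inj_Q] :=
  boolP [exists y, exists z,
    [&& y \notin A, z \notin A, y != z & Q.[y] == Q.[z]]].
  move: yA zA; rewrite !inE !negb_or => /andP[y0 yS] /andP[z0 zS].
  apply: (@RS_not_deep_hole _ _ _ _ _ (f %% P + Q.[y] *: P) [:: y, z & S]) => //.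
  - rewrite (leq_trans (size_polyD _ _)) // geq_max -{1}size_P ltnW ?ltn_modp //.
    by rewrite (leq_trans (size_scale_leq _ _)) ?size_P.
  - by apply: leq_ltn_trans lt_kd; apply: leq_addr.
  - by rewrite /= inE negb_or y_neq_z yS zS uniqS.
  - by rewrite !inE !negb_or ![0 == _]eq_sym y0 z0.
  - have -> : f - (f %% P + Q.[y] *: P) = (Q - Q.[y]%:P) * P.
      by rewrite {1}(divp_eq f P) -/Q -mul_polyC; ring.
    apply/allP=> a; rewrite rootM [in root P a]root_prod_XsubC !inE.
    case/or3P=> [/eqP->|/eqP->|->]; rewrite ?orbT //; apply/orP; left.
      by rewrite rootE !hornerE subrr.
    by rewrite rootE !hornerE Qyz subrr.
  - by rewrite /= size_S prednK //; lia.
(* Without a collision the sum of the values of [Q ^+ m] vanishes, yet it is minus the nonzero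
   coefficient. *)
case/eqP: coefQ; apply: oppr_inj; rewrite oppr0 -sum_horner_coef.
  under eq_bigr do rewrite horner_exp.
  apply: (@sum_horner_expr_eq0 _ _ A); rewrite ?size_Q ?card_A //=.
  - move=> y z; rewrite !inE => yA zA Qyz; apply/eqP; apply: contraT => y_neq_z.
    have /existsPn/(_ z) := inj_Q y.
    by rewrite !inE yA zA y_neq_z Qyz eqxx.
  (* From [3 * d < k], d + 1 is at most (k + 2)/3, and (k + 2)(2k - 1)/3 < (k + 1)^2. *)
  - have lt_sqr : (d.+1 * k.*2.-1 < (k + 1) ^ 2)%N by nia.
    by apply: leq_trans lt_sqr _; rewrite -ltnS (ltn_predK lt_kq).
  - have lt_m q : (d.+1 * m = q + r)%N -> (2 < q)%N -> (m < q)%N by nia.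
    by apply: lt_m Dm _; apply: leq_ltn_trans lt_kd; lia.
(* [Q ^+ m] has degree q - 1 + r, which is below 2(q - 1) because [r <= d]. *)
apply: leq_trans (size_poly_exp_leq _ _) _.
rewrite size_Q /= Dm -addnn -addnS leq_add2l.
by apply: leq_ltn_trans lt_kd; lia.
Qed.
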